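(* Let $M$ be a vertically $4$-connected matroid with a triangle $T = \{e,f,g\}$ such that none of $M \setminus e$, $M \setminus f$, $M \setminus g$ is vertically $4$-connected. Then either (1) $M$ has a cocircuit $C^*$ such that $|C^* \cap T| = 2$ and $M|C^* \cong U_{2,k} \oplus U_{2,2}$ for some integer $k \ge 2$, or (2) $r(M) \le 6$, and, if $M$ has no restriction isomorphic to $U_{2,4}$, then $|E(M)| \le 11$.
   Context: For a matroid $M$ with ground set $E$ and rank function $r$, the connectivity function is $\lambda_M(X) = r(X) + r(E-X) - r(M)$. For a positive integer $j$, a partition $(X,Y)$ of $E$ is a vertical $j$-separation of $M$ if $\lambda_M(X) < j$ and $\min\{r(X), r(Y)\} \ge j$. For an integer $k \ge 2$, $M$ is vertically $k$-connected if it has no vertical $j$-separation with $j < k$. A triangle is a $3$-element circuit. $M|C^*$ denotes the restriction of $M$ to $C^*$; $U_{m,n}$ is the uniform matroid of rank $m$ on $n$ elements and $\oplus$ is direct sum.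
   Formalization: M is additionally assumed to be simple (no loops or parallel elements); without this the claim fails, e.g. for U_{2,3} with nine loops added, which has rank 2, no U_{2,4}-restriction and 12 elements. *)

(* Defs.v *)
From HB Require Import structures.
From mathcomp Require Import all_boot.

Set Implicit Arguments.
Unset Strict Implicit.
Unset Printing Implicit Defensive.

(* Matroids on finite subsets of a finite type S. The ground set is carried
   as a set rather than identified with S, so that a matroid and its
   restrictions live over the same type. *)
Record matroid (S : finType) := Matroid {
  ground : {set S};
  indep : pred {set S};
  indep_ground : forall I, indep I -> I \subset ground;
  indep0 : indep set0;
  indepS : forall I J : {set S}, I \subset J -> indep J -> indep I;
  indep_aug : forall I J : {set S}, indep I -> indep J -> #|I| < #|J| ->
    exists2 x, x \in J :\: I & indep (x |: I)
}.

Section Basics.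
Variables (S : finType) (M : matroid S).
Implicit Types (X Y B C I J : {set S}).

Definition rank X : nat := \max_(I : {set S} | indep M I && (I \subset X)) #|I|.

Definition basis B : bool := maxset (indep M) B.

Definition circuit C : bool :=
  minset [pred D : {set S} | (D \subset ground M) && ~~ indep M D] C.

Definition triangle C : bool := circuit C && (#|C| == 3).

(* No loops (1-element circuits) and no parallel pairs (2-element circuits);
   the empty set is never a circuit. *)
Definition simple_matroid : Prop := forall C, circuit C -> 2 < #|C|.

Lemma indep_extend I J : indep M I -> indep M J -> #|I| <= #|J| ->
  exists K, [/\ indep M K, I \subset K, K \subset I :|: J & #|K| = #|J|].
Proof.
move=> iI iJ; move: {2}(#|J| - #|I|) (erefl (#|J| - #|I|)) => n.
elim: n I iI => [|n IH] I iI En le_IJ.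
  exists I; split=> //; first exact: subsetUl.
  by apply/eqP; rewrite eqn_leq le_IJ /= -subn_eq0 En.
have lt_IJ : #|I| < #|J| by rewrite -subn_gt0 En.
have [x /setDP[xJ xI] ixI] := indep_aug iI iJ lt_IJ.
have cx : #|x |: I| = #|I|.+1 by rewrite cardsU1 xI.
have [||K [iK sK sKJ cK]] := IH _ ixI; rewrite ?cx ?subnS ?En //.
exists K; split=> //; first exact: subset_trans (subsetUr _ _) sK.
apply: subset_trans sKJ _; rewrite -setUA subUset sub1set inE xJ orbT /=.
exact: subxx.
Qed.

Lemma card_basis_ge B I : basis B -> indep M I -> #|I| <= #|B|.
Proof.
move=> /maxsetP[iB maxB] iI; rewrite leqNgt; apply/negP => lt_BI.
have [x /setDP[_ /negP xB] ixB] := indep_aug iB iI lt_BI.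
by apply: xB; rewrite -(maxB _ ixB (subsetUr _ _)) setU11.
Qed.

Lemma card_basis B : indep M B ->
  (forall I, indep M I -> #|I| <= #|B|) -> basis B.
Proof.
move=> iB maxB; apply/maxsetP; split=> // A iA sBA.
by apply/esym/eqP; rewrite eqEcard sBA maxB.
Qed.

Definition dual_indep I : bool :=
  (I \subset ground M) && [exists B : {set S}, basis B && [disjoint I & B]].

Lemma dual_indep_ground I : dual_indep I -> I \subset ground M.
Proof. by case/andP. Qed.

Lemma dual_indep0 : dual_indep set0.
Proof.
rewrite /dual_indep sub0set /=.
have [B bB _] := maxset_exists (indep0 M).
by apply/existsP; exists B; rewrite /basis bB -setI_eq0 set0I eqxx.
Qed.

Lemma dual_indepS I J : I \subset J -> dual_indep J -> dual_indep I.
Proof.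
move=> sIJ /andP[sJ /existsP[B /andP[bB dB]]]; rewrite /dual_indep.
rewrite (subset_trans sIJ sJ); apply/existsP; exists B; rewrite bB.
exact: disjointWl dB.
Qed.

Lemma dual_indep_aug I J : dual_indep I -> dual_indep J -> #|I| < #|J| ->
  exists2 x, x \in J :\: I & dual_indep (x |: I).
Proof.
move=> /andP[sI /existsP[A /andP[bA dA]]] /andP[sJ /existsP[B /andP[bB dB]]].
move=> lt_IJ.
case: (boolP [exists x, (x \in J :\: I) && dual_indep (x |: I)]) => [|/existsPn no].
  by case/existsP => x /andP[]; exists x.
have [[iA _] [iB _]] := (maxsetP bA, maxsetP bB).
have iBI : indep M (B :\: I) by apply: indepS iB; exact: subsetDl.
have leBA : #|B :\: I| <= #|A| by exact: card_basis_ge bA iBI.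
have [K [iK sBK sK cK]] := indep_extend iBI iA leBA.
have bK : basis K.
  by apply: card_basis => // L iL; rewrite cK; exact: card_basis_ge bA iL.
have dIK : [disjoint I & K].
  apply/pred0P => x /=; apply/negP => /andP[xI xK].
  have := subsetP sK _ xK; rewrite !inE xI /= => xA.
  by move/pred0P/(_ x): dA => /=; rewrite xI xA.
have sJK : J :\: I \subset K.
  apply/subsetP => x xJI; have := no x; rewrite xJI /=.
  apply: contraR => xK; rewrite /dual_indep subUset sI sub1set.
  rewrite (subsetP sJ) /=; last by case/setDP: xJI.
  apply/existsP; exists K; rewrite bK /= -setI_eq0 setIUl setU_eq0 !setI_eq0 dIK.
  by rewrite andbT disjoints1.
have: #|(B :\: I) :|: (J :\: I)| <= #|B|.
  apply: (@leq_trans #|K|); first by rewrite subset_leq_card // subUset sBK.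
  exact: card_basis_ge bB iK.
rewrite cardsU (_ : _ :&: _ = set0) ?cards0 ?subn0; last first.
  apply/eqP; rewrite setI_eq0; apply: disjointWr (subsetDl _ _) _.
  by apply: disjointWl (subsetDl _ _) _; rewrite disjoint_sym.
have leBI : #|B :&: I| <= #|I :\: J|.
  apply/subset_leq_card/subsetP => x /setIP[xB xI]; rewrite inE xI andbT.
  by apply/negP => xJ; move/pred0P/(_ x): dB => /=; rewrite xJ xB.
have ltD : #|I :\: J| < #|J :\: I|.
  by rewrite -(ltn_add2l #|I :&: J|) cardsID setIC cardsID.
rewrite -[leqRHS](cardsID I B) addnC leq_add2r => le1.
by have := leq_ltn_trans (leq_trans le1 leBI) ltD; rewrite ltnn.
Qed.

Definition dual : matroid S :=
  Matroid dual_indep_ground dual_indep0 dual_indepS dual_indep_aug.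

Section Restriction.
Variable X : {set S}.

Definition restr_indep I : bool := indep M I && (I \subset X).

Lemma restr_indep_ground I : restr_indep I -> I \subset ground M :&: X.
Proof. by case/andP => iI sI; rewrite subsetI sI (indep_ground iI). Qed.

Lemma restr_indep0 : restr_indep set0.
Proof. by rewrite /restr_indep indep0 sub0set. Qed.

Lemma restr_indepS I J : I \subset J -> restr_indep J -> restr_indep I.
Proof.
by move=> sIJ /andP[iJ sJ]; rewrite /restr_indep (indepS sIJ iJ) (subset_trans sIJ sJ).
Qed.

Lemma restr_indep_aug I J : restr_indep I -> restr_indep J -> #|I| < #|J| ->
  exists2 x, x \in J :\: I & restr_indep (x |: I).
Proof.
move=> /andP[iI sI] /andP[iJ sJ] lt_IJ.
have [x xJI ix] := indep_aug iI iJ lt_IJ; exists x => //.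
rewrite /restr_indep ix subUset sI sub1set (subsetP sJ) //.
by case/setDP: xJI.
Qed.

Definition restriction : matroid S :=
  Matroid restr_indep_ground restr_indep0 restr_indepS restr_indep_aug.

End Restriction.

Definition deletion (X : {set S}) : matroid S := restriction (ground M :\: X).

(* Truncated subtraction is harmless: r(X) + r(E - X) >= r(M). *)
Definition connectivity X : nat :=
  rank X + rank (ground M :\: X) - rank (ground M).

Definition vertical_separation (j : nat) X Y : Prop :=
  [/\ 0 < j, X :|: Y = ground M, [disjoint X & Y],
      connectivity X < j & j <= minn (rank X) (rank Y)].

Definition vertically_connected (k : nat) : Prop :=
  forall j X Y, j < k -> ~ vertical_separation j X Y.

End Basics.

Definition cocircuit (S : finType) (M : matroid S) (C : {set S}) : bool :=
  circuit (dual M) C.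

Section Uniform.
Variables m n : nat.

Definition unif_indep (I : {set 'I_n}) : bool := #|I| <= m.

Lemma unif_indep_ground I : unif_indep I -> I \subset [set: 'I_n].
Proof. by rewrite subsetT. Qed.

Lemma unif_indep0 : unif_indep set0.
Proof. by rewrite /unif_indep cards0. Qed.

Lemma unif_indepS (I J : {set 'I_n}) : I \subset J -> unif_indep J -> unif_indep I.
Proof. by move=> /subset_leq_card; exact: leq_trans. Qed.

Lemma unif_indep_aug (I J : {set 'I_n}) : unif_indep I -> unif_indep J ->
  #|I| < #|J| -> exists2 x, x \in J :\: I & unif_indep (x |: I).
Proof.
rewrite /unif_indep => _ iJ lt_IJ.
have /subsetPn[x xJ xI] : ~~ (J \subset I).
  by apply/negP => /subset_leq_card; rewrite leqNgt lt_IJ.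
exists x; first by rewrite inE xI xJ.
by rewrite cardsU1 xI (leq_trans lt_IJ iJ).
Qed.

(* U_{m,n}, of rank m as long as m <= n. *)
Definition uniform : matroid 'I_n :=
  Matroid unif_indep_ground unif_indep0 unif_indepS unif_indep_aug.

End Uniform.

Section DirectSum.
Variables (S1 S2 : finType) (M1 : matroid S1) (M2 : matroid S2).
Implicit Types I J : {set S1 + S2}.

Definition dsum_ground : {set S1 + S2} :=
  (inl @: ground M1) :|: (inr @: ground M2).

Definition dsum_indep I : bool :=
  indep M1 (inl @^-1: I) && indep M2 (inr @^-1: I).

Lemma dsum_indep_ground I : dsum_indep I -> I \subset dsum_ground.
Proof.
case/andP => /indep_ground/subsetP s1 /indep_ground/subsetP s2.
apply/subsetP => [[x|x] xI]; rewrite inE.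
  by rewrite imset_f ?s1 ?inE.
by rewrite orbC imset_f ?s2 ?inE.
Qed.

Lemma dsum_indep0 : dsum_indep set0.
Proof. by rewrite /dsum_indep !preimset0 !indep0. Qed.

Lemma dsum_indepS I J : I \subset J -> dsum_indep J -> dsum_indep I.
Proof.
move=> sIJ /andP[i1 i2]; apply/andP; split.
  by apply: indepS i1; exact: preimsetS.
by apply: indepS i2; exact: preimsetS.
Qed.

Lemma dsum_card I : #|I| = #|inl @^-1: I : {set S1}| + #|inr @^-1: I : {set S2}|.
Proof.
rewrite -(card_imset _ (@inl_inj S1 S2)) -(card_imset _ (@inr_inj S1 S2)).
rewrite -cardsUI (_ : _ :&: _ = set0) ?cards0 ?addn0; last first.
  apply/setP => x; rewrite !inE; apply/negP => /andP[/imsetP[a _ ->]].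
  by case/imsetP.
apply: eq_card => [[x|x]]; rewrite inE.
  rewrite (mem_imset _ _ (@inl_inj S1 S2)) inE.
  by case: imsetP => [[y _]|_]; rewrite ?orbF.
rewrite (mem_imset _ _ (@inr_inj S1 S2)) inE.
by case: imsetP => [[y _]|_].
Qed.

Lemma dsum_indep_aug I J : dsum_indep I -> dsum_indep J -> #|I| < #|J| ->
  exists2 x, x \in J :\: I & dsum_indep (x |: I).
Proof.
move=> /andP[iI1 iI2] /andP[iJ1 iJ2]; rewrite !dsum_card => lt_IJ.
case: (ltnP #|inl @^-1: I : {set S1}| #|inl @^-1: J : {set S1}|) => [lt1|le1].
  have [x xJI ix] := indep_aug iI1 iJ1 lt1.
  exists (inl x); first by move: xJI; rewrite !inE.
  rewrite /dsum_indep (_ : inl @^-1: _ = x |: inl @^-1: I); last first.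
    by apply/setP => y; rewrite !inE.
  rewrite ix (_ : inr @^-1: _ = inr @^-1: I) //.
  by apply/setP => y; rewrite !inE.
have lt2 : #|inr @^-1: I : {set S2}| < #|inr @^-1: J : {set S2}|.
  rewrite ltnNge; apply/negP => le2.
  by move: lt_IJ; rewrite ltnNge leq_add.
have [x xJI ix] := indep_aug iI2 iJ2 lt2.
exists (inr x); first by move: xJI; rewrite !inE.
rewrite /dsum_indep andbC (_ : inr @^-1: _ = x |: inr @^-1: I); last first.
  by apply/setP => y; rewrite !inE.
rewrite ix (_ : inl @^-1: _ = inl @^-1: I) //.
by apply/setP => y; rewrite !inE.
Qed.

Definition direct_sum : matroid (S1 + S2)%type :=
  Matroid dsum_indep_ground dsum_indep0 dsum_indepS dsum_indep_aug.

End DirectSum.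

Definition isomorphic (S1 S2 : finType) (M1 : matroid S1) (M2 : matroid S2) :
    Prop :=
  exists2 f : {x | x \in ground M1} -> {y | y \in ground M2},
    bijective f &
    forall I : {set {x | x \in ground M1}},
      indep M2 [set val (f x) | x in I] = indep M1 [set val x | x in I].

(* Main.v *)
(* Outside a degenerate case (two sides of rank at most 2), deleting a in
   T = {a, b, c} leaves a separation (X, Y) of M \ a with r(X) + r(Y) = r(M) + 2,
   both ranks at least 3, b in X, c in Y, and a in the span of neither side.
   Suppose that M has no cocircuit as in (1). Crossing the separations for a and
   b, submodularity forces the two cells that avoid T on the diagonal missing c
   to have rank exactly 2, and either the other cell avoiding T is a single
   point, or the cell containing c has rank at most 2. Any failure produces a
   hyperplane whose complement is a line plus two points of rank 4, which is the
   excluded cocircuit. Applying this to the three pairs of separations bounds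
   the rank by 6, and covers E - T by six lines that meet in threes in two of
   the eight triple cells; lines have at most three points when there is no
   U_{2,4}, and counting gives |E - T| <= 8. *)
Require Import Defs.
From mathcomp Require Import all_boot.
From mathcomp Require Import zify.
From Stdlib Require Import Classical_Prop.

Set Implicit Arguments.
Unset Strict Implicit.
Unset Printing Implicit Defensive.

(** * Rank function, closure and cocircuits *)

Section RankTheory.
Variables (S : finType) (M : matroid S).
Implicit Types (X Y Z I J : {set S}) (x y : S).
Local Notation r := (rank M).

Lemma rank_basis X : exists I, [/\ indep M I, I \subset X & #|I| = r X].
Proof.
have c0 : 0 < #|[pred I : {set S} | indep M I && (I \subset X)]|.
  by apply/card_gt0P; exists set0; rewrite inE indep0 sub0set.
have [I /andP[iI sI] EI] := eq_bigmax_cond (fun I : {set S} => #|I|) c0.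
by exists I; split=> //; rewrite -EI.
Qed.

Lemma rank_ge I X : indep M I -> I \subset X -> #|I| <= r X.
Proof.
move=> iI sI; apply: (@leq_bigmax_cond _ _ (fun I => #|I|)).
by rewrite iI sI.
Qed.

Lemma rankS X Y : X \subset Y -> r X <= r Y.
Proof.
move=> sXY; have [I [iI sI <-]] := rank_basis X.
exact: rank_ge (subset_trans sI sXY).
Qed.

Lemma rank_le_card X : r X <= #|X|.
Proof. by have [I [_ sI <-]] := rank_basis X; apply: subset_leq_card. Qed.

Lemma rank_indep I : indep M I -> r I = #|I|.
Proof. by move=> iI; apply/eqP; rewrite eqn_leq rank_le_card rank_ge. Qed.

Lemma indep_rank I : #|I| <= r I -> indep M I.
Proof.
have [J [iJ sJ <-]] := rank_basis I => le.
by have /eqP <- : J == I by rewrite eqEcard sJ.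
Qed.

(** A basis of the intersection extends to a basis [K] of the union; the traces of [K] on [X] and
    [Y] are independent and overlap in at least the basis of the intersection. *)
Lemma rank_submod X Y : r (X :|: Y) + r (X :&: Y) <= r X + r Y.
Proof.
have [I [iI sI cI]] := rank_basis (X :&: Y).
have [J [iJ sJ cJ]] := rank_basis (X :|: Y).
have leIJ : #|I| <= #|J|.
  by rewrite cI cJ rankS // subIset // subsetUl.
have [K [iK sIK sK cK]] := indep_extend iI iJ leIJ.
have sKU : K \subset X :|: Y.
  apply: subset_trans sK _; rewrite subUset sJ andbT.
  by apply: subset_trans sI _; rewrite subIset // subsetUl.
have leX : #|K :&: X| <= r X by rewrite rank_ge ?subsetIr ?(indepS (subsetIl _ _) iK).
have leY : #|K :&: Y| <= r Y by rewrite rank_ge ?subsetIr ?(indepS (subsetIl _ _) iK).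
have := cardsUI (K :&: X) (K :&: Y).
rewrite -setIUr -setIIr (setIidPl sKU) => E.
have leI : #|I| <= #|K :&: (X :&: Y)| by rewrite subset_leq_card // subsetI sIK.
by rewrite -cJ -cK -cI; move: leX leY leI E; clear; lia.
Qed.

Lemma rankU X Y : r (X :|: Y) <= r X + r Y.
Proof. by have := rank_submod X Y; lia. Qed.

Lemma rankU1 x X : r (x |: X) <= (r X).+1.
Proof. by have := rankU [set x] X; have := rank_le_card [set x]; rewrite cards1; lia. Qed.

(** The inequality [r (x |: X) <= r X] encodes that x lies in the span of [X]; the claim is
    submodularity applied to [x |: X] and [Y]. *)
Lemma span_mono x X Y : X \subset Y -> r (x |: X) <= r X -> r (x |: Y) <= r Y.
Proof.
move=> sXY; have := rank_submod (x |: X) Y.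
rewrite -setUA (setUidPr sXY).
have : r X <= r ((x |: X) :&: Y) by rewrite rankS // subsetI subsetUr.
lia.
Qed.

Lemma rank_span X Z : (forall z, z \in Z -> r (z |: X) <= r X) -> r (X :|: Z) = r X.
Proof.
move=> spZ; apply/eqP; rewrite eqn_leq andbC rankS ?subsetUl //= leqNgt.
apply/negP => lt.
have [I [iI sI cI]] := rank_basis X.
have [J [iJ sJ cJ]] := rank_basis (X :|: Z).
have [|x /setDP[xJ xI] ix] := indep_aug iI iJ; first by rewrite cI cJ.
have sxI : x |: I \subset x |: X by rewrite setUS.
have /setUP[xX|xZ] := subsetP sJ _ xJ; have := rank_ge ix sxI; rewrite cardsU1 xI cI.
  by rewrite (setUidPr _) ?sub1set // ltnn.
by move/leq_trans/(_ (spZ _ xZ)); rewrite ltnn.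
Qed.

(** Points off the ground set never raise the rank, so membership in [ground M] is imposed
    separately. *)
Definition closure X : {set S} := [set x in ground M | r (x |: X) == r X].

Lemma sub_closure X : X \subset ground M -> X \subset closure X.
Proof.
move=> sX; apply/subsetP=> x xX.
by rewrite inE (subsetP sX) //= (setUidPr _) // sub1set.
Qed.

Lemma rank_closure X : X \subset ground M -> r (closure X) = r X.
Proof.
move=> sX; rewrite -{1}(setUidPr (sub_closure sX)); apply: rank_span => z.
by rewrite inE => /andP[_ /eqP->].
Qed.

Lemma basisE (B : {set S}) :
  (B \subset ground M) && indep M B && (r (ground M) <= #|B|) = basis M B.
Proof.
apply/idP/idP=> [/andP[/andP[_ iB] le]|bB].
  by apply: card_basis => // I iI; apply: leq_trans le; rewrite rank_ge // indep_ground.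
have [iB _] := maxsetP bB; rewrite indep_ground // iB /=.
by have [I [iI _ <-]] := rank_basis (ground M); apply: card_basis_ge iI.
Qed.

Lemma dual_indep_rank I : I \subset ground M ->
  dual_indep M I = (r (ground M) <= r (ground M :\: I)).
Proof.
move=> sI; rewrite /dual_indep sI /=; apply/existsP/idP=> [[B /andP[]]|le].
  rewrite -basisE => /andP[/andP[sB iB] le] dis.
  apply: (leq_trans le); rewrite rank_ge // subsetD sB disjoint_sym //.
have [B [iB sB cB]] := rank_basis (ground M :\: I).
exists B; move: sB; rewrite subsetD => /andP[sB dB].
by rewrite -basisE sB iB cB le disjoint_sym.
Qed.

(** The complement of a hyperplane meets every basis. A proper subset misses some x outside the
    hyperplane, and its complement then contains [x |: Y], which is spanning. *)
Lemma cocircuit_hyperplane Y : Y \subset ground M -> (r Y).+1 = r (ground M) ->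
  cocircuit M (ground M :\: closure Y).
Proof.
move=> sY rY; set H := closure Y.
have sH : H \subset ground M by apply/subsetP=> x; rewrite inE => /andP[].
have rH : r H = r Y by apply: rank_closure.
apply/minsetP; split=> [|D].
  rewrite inE /= subsetDl /= dual_indep_rank ?subsetDl //.
  by rewrite setDDr setDv set0U (setIidPr sH) rH -rY ltnn.
rewrite !inE /= => /andP[sD nD] sDH; apply/eqP; rewrite eqEsubset sDH /=.
apply/subsetP=> x xDH; apply: contraR nD => xD.
have /setDP[xE xH] := xDH.
rewrite dual_indep_rank // -rY.
have : x |: Y \subset ground M :\: D.
  rewrite subUset sub1set in_setD xD xE /= subsetD sY /=.
  rewrite disjoint_sym disjoints_subset (subset_trans sDH) //.
  by apply/subsetP=> z; rewrite !inE;
     case: (z \in Y) (subsetP (sub_closure sY) z) => // /(_ isT); rewrite inE => ->.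
move/rankS; apply: leq_trans; move: xH; rewrite inE xE /= => ne.
by have := rankS (subsetUr [set x] Y); rewrite leq_eqVlt eq_sym (negPf ne).
Qed.

(** * Small sets in simple matroids *)

Section Simple.
Hypothesis simpleM : simple_matroid M.

Lemma simple_indep X : X \subset ground M -> #|X| <= 2 -> indep M X.
Proof.
move=> sX cX; apply: contraT => nX.
have pX : [pred D : {set S} | (D \subset ground M) && ~~ indep M D] X by rewrite /= sX.
have [C mC sC] := minset_exists pX.
have := simpleM mC; have := subset_leq_card sC; lia.
Qed.

Lemma simple_rank_ge X : X \subset ground M -> minn 2 #|X| <= r X.
Proof.
move=> sX; case: (leqP #|X| 2) => cX.
  by rewrite rank_indep ?simple_indep // geq_minr.
have /set0Pn[x xX] : X != set0 by rewrite -card_gt0; lia.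
have cX1 := cardsD1 x X; rewrite xX in cX1.
have /set0Pn[y yX] : X :\ x != set0 by rewrite -card_gt0; lia.
move: yX; rewrite !inE => /andP[ny yX].
have sxy : [set x; y] \subset X by rewrite subUset !sub1set xX.
have c2 : #|[set x; y]| = 2 by rewrite cards2 eq_sym ny.
have i2 : indep M [set x; y].
  by rewrite simple_indep ?c2 // (subset_trans sxy).
by have := rank_ge i2 sxy; rewrite c2; lia.
Qed.

End Simple.
End RankTheory.

(** * Recognising restrictions as uniform matroids and their sums *)

Lemma isomorphic_intro (S1 S2 : finType) (M1 : matroid S1) (M2 : matroid S2)
    (h : S1 -> S2) :
  {in ground M1 &, injective h} -> h @: ground M1 = ground M2 ->
  (forall I : {set S1}, I \subset ground M1 -> indep M2 (h @: I) = indep M1 I) ->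
  isomorphic M1 M2.
Proof.
move=> injh imh indh.
have hP (x : {x | x \in ground M1}) : h (val x) \in ground M2.
  by rewrite -imh imset_f // (valP x).
exists (fun x => exist _ (h (val x)) (hP x)) => [|I].
  apply: inj_card_bij => [x y /(congr1 val) /= /injh E|].
    by apply/val_inj/E; exact: valP.
  by rewrite !card_sig -imh leq_imset_card.
rewrite -indh; last by apply/subsetP=> _ /imsetP[x _ ->]; exact: valP.
by rewrite -imset_comp.
Qed.

(** Numbers the points of [A] by their position in [enum A]; [inord] dictates the successor form of
    the bound. *)
Lemma index_enum_inj (T : finType) (A : {set T}) n : #|A| = n.+1 ->
  {in A &, injective (fun x => inord (index x (enum A)) : 'I_n.+1)}.
Proof.
move=> cA x y xA yA /(congr1 (@nat_of_ord _)).
rewrite !inordK; try by rewrite -cA cardE index_mem mem_enum.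
move=> E; rewrite -(nth_index x (_ : x \in enum A)) ?mem_enum // E nth_index //.
by rewrite mem_enum.
Qed.

Section Isomorphisms.
Variables (S : finType) (M : matroid S).
Hypothesis simpleM : simple_matroid M.
Implicit Types (X Y D I : {set S}).
Local Notation r := (rank M).

(** Any four points of the line will do: pairs are independent by simplicity, triples are dependent
    by rank. *)
Lemma long_line_U24 X : X \subset ground M -> r X <= 2 -> 3 < #|X| ->
  exists Y, Y \subset ground M /\ isomorphic (restriction M Y) (uniform 2 4).
Proof.
move=> sX rX cX.
have : 0 < #|[set A : {set S} | A \subset X & #|A| == 4]| by rewrite cards_draws bin_gt0.
case/card_gt0P=> Y; rewrite inE => /andP[sY /eqP cY].
have sYE := subset_trans sY sX; exists Y; split=> //.
have injY := index_enum_inj cY.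
apply: (@isomorphic_intro _ _ _ _ (fun x => inord (index x (enum Y)) : 'I_4)) => /=.
- by move=> x y /setIP[_ xY] /setIP[_ yY]; apply: injY.
- rewrite (setIidPr sYE); apply/eqP.
  by rewrite eqEcard subsetT card_in_imset // cY cardsT card_ord.
move=> I; rewrite (setIidPr sYE) /restr_indep /unif_indep => sI.
rewrite card_in_imset; last by apply: sub_in2 injY; exact/subsetP.
rewrite sI andbT; apply/idP/idP=> [c2|iI].
  by apply: simple_indep => //; exact: subset_trans sYE.
by have := rank_ge iI (subset_trans sI sY); lia.
Qed.

(** Rank 4 leaves no slack: y and z must be distinct points of [D], each raising the rank of the
    remaining line by one, hence coloops of the restriction to [D]. *)
Lemma line_plus_two_coloops D y z : D \subset ground M -> 4 <= r D ->
    r (D :\: [set y; z]) <= 2 ->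
  exists k, 2 <= k /\
    isomorphic (restriction M D) (direct_sum (uniform 2 k) (uniform 2 2)).
Proof.
move=> sD rD; set L := D :\: _ => rL.
have rDL : r D <= r L + #|D :&: [set y; z]|.
  rewrite -{1}(setID D [set y; z]) setUC.
  by apply: leq_trans (rankU _ _ _) _; rewrite leq_add2l rank_le_card.
have c2 : #|[set y; z]| = 1 + (y != z) by rewrite cards2.
have := subset_leq_card (subsetIr D [set y; z]); rewrite c2 => le2.
have nyz : y != z by move: le2; case: eqP => //=; lia.
have /setIidPr syz : [set y; z] \subset D.
  by apply/setIidPr/eqP; rewrite eqEcard subsetIr c2 nyz; lia.
have {rDL c2 le2} r4 : r L = 2 by move: rDL; rewrite syz c2 nyz; lia.
have /setIidPr := syz; rewrite subUset !sub1set => /andP[yD zD].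
have sL : L \subset D by apply: subsetDl.
have cL := rank_le_card M L; rewrite r4 in cL.
case Ek : #|L| cL => [|[|k]] // _.
exists k.+2; split=> //.
have injL := index_enum_inj Ek.
pose g x : 'I_k.+2 := inord (index x (enum L)).
pose h x : 'I_k.+2 + 'I_2 :=
  if x == y then inr ord0 else if x == z then inr ord_max else inl (g x).
have hL x : x \in L -> h x = inl (g x).
  by rewrite !inE negb_or /h => /andP[/andP[/negPf-> /negPf->]].
have DL x : x \in D -> [|| x == y, x == z | x \in L].
  by rewrite !inE => ->; case: (x == y) (x == z) => [] [].
have hy : h y = inr ord0 by rewrite /h eqxx.
have hz : h z = inr ord_max by rewrite /h eqxx eq_sym (negPf nyz).
have preL I : I \subset D -> inl @^-1: (h @: I) = g @: (I :&: L).
  move=> sI; apply/setP=> i; rewrite inE.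
  apply/imsetP/imsetP=> [[x xI]|[x /setIP[xI xL] ->]].
    have /or3P[/eqP->|/eqP->|xL] := DL _ (subsetP sI _ xI); rewrite ?hy ?hz //.
    by rewrite hL // => -[->]; exists x => //; rewrite inE xI.
  by exists x; rewrite ?hL.
have injh : {in D &, injective h}.
  move=> x x' /DL /or3P[/eqP->|/eqP->|xL] /DL /or3P[/eqP->|/eqP->|xL'] //;
    rewrite ?hy ?hz ?(hL _ xL) ?(hL _ xL') // => -[]; exact: injL.
apply: (@isomorphic_intro _ _ _ _ h) => /=; rewrite (setIidPr sD) //.
  apply/eqP; rewrite eqEcard; apply/andP; split.
    apply/subsetP=> -[i|i] _; rewrite !inE ?imset_f ?inE ?orbT //.
  rewrite card_in_imset // -(cardsID [set y; z] D) syz -/L Ek cards2 nyz.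
  apply: leq_trans (leq_card_setU _ _) _.
  rewrite !card_imset ?cardsT ?card_ord; [lia|exact: inr_inj|exact: inl_inj].
move=> I sI; rewrite /dsum_indep /= /unif_indep preL // /restr_indep sI andbT.
rewrite (_ : #|inr @^-1: _| <= 2) ?andbT; last first.
  by apply: leq_trans (max_card _) _; rewrite card_ord.
rewrite card_in_imset; last by apply: sub_in2 injL => x /setIP[].
apply/idP/idP=> [cI|iI]; last first.
  by rewrite -r4 rank_ge ?subsetIr // (indepS (subsetIl _ _) iI).
have iIL : indep M (I :&: L).
  by apply: simple_indep => //; apply: subset_trans sD; rewrite subIset // sI.
have [B [iB sB cB]] := rank_basis M L.
have [|K [iK sIK sK cK]] := indep_extend iIL iB; first by rewrite cB r4.
have sKL : K \subset L by apply: subset_trans sK _; rewrite subUset subsetIr.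
have rK : r K = 2 by rewrite rank_indep // cK cB.
have spK x : x \in L -> r (x |: K) <= r K.
  by move=> xL; rewrite rK -r4 rankS // subUset sub1set xL.
apply: (@indepS _ _ _ (K :|: [set y; z])).
  apply/subsetP=> x xI; rewrite in_setU in_set2.
  case/or3P: (DL _ (subsetP sI _ xI)) => [->|->|xL]; rewrite ?orbT //.
  by rewrite (subsetP sIK) // in_setI xI.
(* [K] with y and z has at most four points and spans [D], because [K] spans the line [L]; rank at
   least 4 then forces independence. *)
apply: indep_rank; rewrite (leq_trans (leq_card_setU _ _)) //.
rewrite cards2 nyz -(rank_indep iK) rK.
apply: leq_trans rD _.
have <- : r (K :|: [set y; z] :|: L) = r (K :|: [set y; z]).
  apply: rank_span => x xL; apply: span_mono (spK _ xL); exact: subsetUl.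
by apply: rankS; rewrite -(setID D [set y; z]) syz subUset subsetUr andbT
  -setUA subsetU // subsetUl orbT.
Qed.

End Isomorphisms.

(** * Vertical 4-connectivity and separations of a one-element deletion *)

Definition has_good_cocircuit (S : finType) (M : matroid S) (T : {set S}) : Prop :=
  exists C : {set S},
    [/\ cocircuit M C, #|C :&: T| = 2 &
        exists k : nat, 2 <= k /\
          isomorphic (restriction M C)
                     (direct_sum (uniform 2 k) (uniform 2 2))].

Lemma rank_restriction (S : finType) (M : matroid S) (Z X : {set S}) :
  rank (restriction M Z) X = rank M (X :&: Z).
Proof.
by apply: eq_bigl => I; rewrite /= /restr_indep subsetI -andbA [(I \subset Z) && _]andbC.
Qed.

Section Separations.
Variables (S : finType) (M : matroid S).
Hypothesis connM : vertically_connected M 4.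
Implicit Types (X Y : {set S}) (a x : S).
Local Notation r := (rank M).
Local Notation E := (ground M).

(** If the inequality failed, [X] and its complement would form a vertical j-separation with j the
    minimum on the left; for j = 0 it is subadditivity. *)
Lemma vconn_rank X : X \subset E ->
  r E + minn 3 (minn (r X) (r (E :\: X))) <= r X + r (E :\: X).
Proof.
move=> sX; have UX : X :|: (E :\: X) = E.
  by rewrite -{1}(setIidPr sX) setID.
have := rankU M X (E :\: X); rewrite UX => leE.
set j := minn _ _; case: (posnP j) => [->|j0]; first by rewrite addn0.
rewrite leqNgt; apply/negP => lt.
apply: (connM (j := j) (X := X) (Y := E :\: X)); first by rewrite /j; lia.
split=> //; last exact: geq_minr.
  by rewrite disjoint_sym disjoints_subset subDset setUCr subsetT.
rewrite /connectivity; lia.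
Qed.

Lemma vconn_rank3 X : X \subset E -> 3 <= r (E :\: X) ->
  r E + minn 3 (r X) <= r X + r (E :\: X).
Proof. by move=> /vconn_rank; clear; lia. Qed.

(** A vertical 3-separation of the deletion of a, measured in [M]: the sides avoid a, and [r E]
    equals the rank of [E :\ a] unless a is a coloop. *)
Record separation a X Y : Prop := Separation {
  sep_cover : X :|: Y = E :\ a;
  sep_disjoint : [disjoint X & Y];
  sep_rankl : 3 <= r X;
  sep_rankr : 3 <= r Y;
  sep_rank : r X + r Y <= r E + 2 }.

Lemma separationC a X Y : separation a X Y -> separation a Y X.
Proof.
by case=> c d rX rY le; split; rewrite // 1?setUC // 1?disjoint_sym // addnC.
Qed.

(** Boolean form of the partition, so that later set identities reduce to cases on memberships. *)
Lemma separation_mem a X Y x : separation a X Y ->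
  [&& ((x \in X) || (x \in Y)) == (x \in E) && (x != a)
    & ~~ ((x \in X) && (x \in Y))].
Proof.
case=> c d _ _ _; rewrite -in_setU c in_setD1 [X in X == _]andbC eqxx /=.
by move: d; rewrite -setI_eq0 => /eqP/setP/(_ x); rewrite !inE => ->.
Qed.

Lemma separation_sub a X Y : separation a X Y -> (X \subset E) /\ (Y \subset E).
Proof.
by move=> s; split; apply/subsetP=> x; move: (separation_mem x s);
   case: (x \in X) (x \in Y) (x \in E) => [] [] [].
Qed.

Lemma separation_compl a X Y : a \in E -> separation a X Y -> E :\: (a |: X) = Y.
Proof.
move=> aE s; apply/setP=> x; rewrite !inE; move: (separation_mem x s).
by case: (x \in X) (x \in Y) (x \in E) (x == a) => [] [] [] [].
Qed.

(** Moving a into [X] gives a partition of [E] with both ranks at least 3, so the ranks then sum to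
    at least [r E + 3]. Hence a raises the rank of [X], and the bound [r E + 2] is attained. *)
Lemma separation_nspan a X Y : a \in E -> separation a X Y ->
  r X < r (a |: X) /\ r X + r Y = r E + 2.
Proof.
move=> aE s; have [sX _] := separation_sub s; have [_ _ r1 r2 le] := s.
have := vconn_rank (_ : a |: X \subset E); rewrite (separation_compl aE s).
rewrite subUset sub1set aE sX => /(_ isT).
move: r1 r2 le (rankU1 M a X) (rankS M (subsetUr [set a] X)).
by clear; lia.
Qed.

End Separations.

(* [u] and [v] count the two cells lying in three of the six rank-2 cells of
   [crossing]; the [a]s and [b]s count the remaining cells. *)
Lemma cell_count (a1 a2 a3 b1 b2 b3 u v : nat) :
  2 <= a1 + u <= 3 -> 2 <= a2 + u <= 3 -> 2 <= a3 + u <= 3 ->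
  2 <= b1 + v <= 3 -> 2 <= b2 + v <= 3 -> 2 <= b3 + v <= 3 ->
  (2 <= u -> a1 + a2 + a3 + u <= 3) -> (2 <= v -> b1 + b2 + b3 + v <= 3) ->
  a1 + b1 = 1 \/ (a3 <= 1 /\ b3 <= 1) ->
  b2 + a3 = 1 \/ (a2 <= 1 /\ b1 <= 1) ->
  a2 + b3 = 1 \/ (a1 <= 1 /\ b2 <= 1) ->
  a1 + a2 + a3 + u + (b1 + b2 + b3 + v) <= 8.
Proof. by lia. Qed.

(** * Separations of the deletions at the points of a triangle *)

Section Triangle.
Variables (S : finType) (M : matroid S) (T : {set S}).
Hypotheses (simpleM : simple_matroid M) (connM : vertically_connected M 4).
Hypothesis triT : triangle M T.
Implicit Types (X Y A B : {set S}) (a b c x y z : S).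
Local Notation r := (rank M).
Local Notation E := (ground M).

Definition labels a b c := [/\ T = [set a; b; c], a != b, a != c & b != c].

Lemma labelsC a b c : labels a b c -> labels b a c.
Proof.
by rewrite /labels => -[-> ab ac bc]; split; rewrite // 1?eq_sym // [[set b; a]]setUC.
Qed.

Lemma labels_rot a b c : labels a b c -> labels b c a.
Proof.
rewrite /labels => -[-> ab ac bc]; split; rewrite // 1?eq_sym //.
by rewrite [RHS]setUC setUA.
Qed.

Lemma subT : T \subset E.
Proof. by case/andP: triT => /minsetP[/andP[]]. Qed.

Lemma labels_sub a b c : labels a b c -> [/\ a \in E, b \in E & c \in E].
Proof.
by case=> defT _ _ _; have := subT; rewrite defT !subUset !sub1set => /andP[/andP[]].
Qed.

(** The triangle has rank 2, and by simplicity b and c already have rank 2. *)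
Lemma labels_span a b c X : labels a b c -> b \in X -> c \in X ->
  r (a |: X) <= r X.
Proof.
move=> labT bX cX; have [aE bE cE] := labels_sub labT.
have [defT _ _ bc] := labT.
apply: (@span_mono _ _ _ [set b; c]); first by rewrite subUset !sub1set bX.
have /andP[/minsetP[/andP[_ nT] _] /eqP cT] := triT.
have rT : r T < 3.
  by rewrite ltnNge; apply: contra nT => le; apply: indep_rank; rewrite cT.
have r2 : 2 <= r [set b; c].
  have := simple_rank_ge simpleM (_ : [set b; c] \subset E).
  by rewrite cards2 bc => -> //; rewrite subUset !sub1set bE.
by rewrite (leq_trans _ r2) // setUA -defT.
Qed.

(** The hyperplane spanned by [Y] contains c but not a, hence not b, since b and c span a. So its
    complement meets [T] in a and b; vertical 4-connectivity gives this complement rank at least 4,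
    and removing y and z leaves a line. *)
Lemma hyperplane_good_cocircuit a b c Y y z :
  labels a b c -> Y \subset E -> c \in Y -> (r Y).+1 = r E -> 3 <= r Y ->
  r Y < r (a |: Y) -> r ((E :\: Y) :\: [set y; z]) <= 2 ->
  has_good_cocircuit M T.
Proof.
move=> labT sY cY rY r3 aY rD; have [aE bE cE] := labels_sub labT.
pose D := E :\: closure M Y; exists D.
have sYH := sub_closure sY.
have sHE : closure M Y \subset E by apply/subsetP=> x; rewrite inE => /andP[].
have aH : a \notin closure M Y by rewrite inE aE /= neq_ltn aY orbT.
have cH : c \in closure M Y by apply: (subsetP sYH).
have bH : b \notin closure M Y.
  apply: contraL aY => bH; rewrite -leqNgt -(rank_closure sY).
  apply: leq_trans (labels_span labT bH cH).
  by rewrite rankS // setUS.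
split; first exact: cocircuit_hyperplane.
  have [-> ab _ _] := labT.
  rewrite (_ : _ :&: _ = [set a; b]) ?cards2 ?ab //.
  apply/setP=> x; rewrite in_setI in_setD !in_setU !in_set1.
  case: eqP => [->|_]; first by rewrite aH aE.
  case: eqP => [->|_]; first by rewrite bH bE.
  by case: eqP => [->|_]; rewrite ?cH // andbF.
apply: (line_plus_two_coloops simpleM (y := y) (z := z)); first exact: subsetDl.
  have := vconn_rank connM (subsetDl E (closure M Y)).
  rewrite -/D setDDr setDv set0U (setIidPr sHE) (rank_closure sY).
  by move: rY r3; clear; lia.
by apply: leq_trans rD; rewrite rankS // setSD // setDS.
Qed.

(** If b and c were on one side, that side would span a. *)
Lemma separation_split a b c X Y : labels a b c -> separation M a X Y ->
  (b \in X /\ c \in Y) \/ (b \in Y /\ c \in X).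
Proof.
move=> labT s; have [aE bE cE] := labels_sub labT; have [_ ab ac _] := labT.
have [nX _] := separation_nspan connM aE s.
have [nY _] := separation_nspan connM aE (separationC s).
move: (separation_mem b s) (separation_mem c s); rewrite bE cE ![_ == a]eq_sym ab ac.
case bX : (b \in X); case cX : (c \in X); rewrite ?orbT ?orbF //=.
- by move: nX; rewrite ltnNge (labels_span labT bX cX).
- by move=> _ /andP[/eqP-> _]; left.
- by move=> /andP[/eqP-> _] _; right.
move=> /andP[/eqP bY _] /andP[/eqP cY _].
by move: nY; rewrite ltnNge (labels_span labT bY cY).
Qed.

(* The other side spans a hyperplane whose complement is [a], the coloop [x]
   and points of a line. *)
Lemma rank3_coloop a b c X Y x : labels a b c -> separation M a X Y ->
  b \in X -> c \in Y -> r X = 3 -> r (X :\ x) <= 2 -> has_good_cocircuit M T.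
Proof.
move=> labT s bX cY rX rXx; have [aE bE cE] := labels_sub labT.
have [_ sY] := separation_sub s.
have [nY _] := separation_nspan connM aE (separationC s).
have [_ eqr] := separation_nspan connM aE s.
apply: (hyperplane_good_cocircuit labT sY cY (y := a) (z := x)) => //.
- by move: eqr rX; clear; lia.
- exact: sep_rankr s.
apply: leq_trans rXx; rewrite rankS //; apply/subsetP=> z; move: (separation_mem z s).
rewrite !inE.
by case: (z \in X) (z \in Y) (z \in E) (z == a) (z == x) => [] [] [] [] [].
Qed.

(** Order 3 gives the first outcome. At order j at most 2 the rank sum stays within [r E + 2] after
    a joins either side, so vertical 4-connectivity of [M] and the lower bound j on both ranks leave
    only sides of rank at most 2. *)
Lemma deletion_separation a b c :
  labels a b c -> ~ vertically_connected (deletion M [set a]) 4 ->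
  (exists X Y, [/\ separation M a X Y, b \in X & c \in Y])
  \/ (exists X Y, [/\ X :|: Y = E :\ a, r X <= 2 & r Y <= 2]).
Proof.
move=> labT nconn; have [aE bE cE] := labels_sub labT.
have [_ ab ac _] := labT.
apply: NNPP => no; apply: nconn => j X Y j4 [j0 cov dis].
rewrite /connectivity /= !rank_restriction.
have gE : E :&: (E :\: [set a]) = E :\ a by rewrite (setIidPr (subsetDl _ _)).
rewrite /= gE in cov *.
have rE : r (E :\ a) = r E.
  apply/eqP; rewrite eqn_leq rankS ?subsetDl //=.
  have := labels_span labT (_ : b \in E :\ a) (_ : c \in E :\ a).
  rewrite !inE bE cE ![_ == a]eq_sym ab ac; move=> /(_ isT isT).
  by apply: leq_trans; rewrite rankS // setD1K.
have sX : X \subset E :\ a by rewrite -cov subsetUl.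
have sY : Y \subset E :\ a by rewrite -cov subsetUr.
have cY : (E :\ a) :\: X = Y.
  by rewrite -cov setDUl setDv set0U; apply/setDidPl; rewrite disjoint_sym.
have cX : (E :\ a) :\: Y = X.
  by rewrite -cov setDUl setDv setU0; apply/setDidPl.
rewrite cY (setIidPl sX) (setIidPl sY) setIid rE => lt le.
have sEa : E :\ a \subset E by apply: subsetDl.
have vcompl (Z W : {set S}) : Z \subset E :\ a -> (E :\ a) :\: Z = W ->
    r E + minn 3 (minn (r (a |: Z)) (r W)) <= r (a |: Z) + r W.
  move=> sZ <-; rewrite setDDl; apply: vconn_rank => //.
  by rewrite subUset sub1set aE (subset_trans sZ sEa).
have [j3|j2] := leqP 3 j; last first.
  apply: no; right; exists X, Y; split=> //.
    move: (vcompl X Y sX cY) (vcompl Y X sY cX) j2 lt le.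
    move: (rankU1 M a X) (rankU1 M a Y).
    move: (rankS M (subsetUr [set a] X)) (rankS M (subsetUr [set a] Y)).
    by clear; lia.
  move: (vcompl X Y sX cY) (vcompl Y X sY cX) j2 lt le.
  move: (rankU1 M a X) (rankU1 M a Y).
  move: (rankS M (subsetUr [set a] X)) (rankS M (subsetUr [set a] Y)).
  by clear; lia.
have sepX : separation M a X Y.
  by split=> //; move: j3 j4 le lt; clear; lia.
apply: no; left.
have [[bX cY']|[bY cX']] := separation_split labT sepX; first by exists X, Y.
by exists Y, X; split=> //; apply: separationC.
Qed.

(** One point and two lines: rank at most 5, and at most 7 elements if lines have at most three
    points. *)
Lemma small_sides_bound a X Y : a \in E -> X :|: Y = E :\ a -> r X <= 2 -> r Y <= 2 ->
  r E <= 6 /\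
  ((~ exists X : {set S}, X \subset E /\ isomorphic (restriction M X) (uniform 2 4)) ->
    #|E| <= 11).
Proof.
move=> aE cov rX rY; rewrite -(setD1K aE) -cov; split.
  by move: (rankU1 M a (X :|: Y)) (rankU M X Y) rX rY; clear; lia.
move=> noU24; have line (Z : {set S}) : Z \subset E :\ a -> r Z <= 2 -> #|Z| <= 3.
  move=> sZ rZ; rewrite leqNgt; apply/negP => lt; apply: noU24.
  have sZE := subset_trans sZ (subsetDl E [set a]).
  by have [Z' [sZ' iso]] := long_line_U24 simpleM sZE rZ lt; exists Z'; rewrite cov setD1K.
have cX := line X; have cY := line Y; rewrite -cov subsetUl subsetUr in cX cY.
move: (cardsU1 a (X :|: Y)) (leq_card_setU X Y).1 (cX isT rX) (cY isT rY).
by case: (a \notin _) => /=; clear; lia.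
Qed.

(** * Crossing two separations in the absence of a good cocircuit *)

Hypothesis no_good : ~ has_good_cocircuit M T.

(** Suppose b is a coloop of the side [X]. In rank 3 this yields a good cocircuit. In higher rank,
    moving a and b to the other side costs only one there, as b and c span a, so the rank sum stays
    at most [r E + 2], against vertical 4-connectivity. *)
Lemma separation_not_coloop a b c X Y : labels a b c -> separation M a X Y ->
  b \in X -> c \in Y -> r (X :\ b) = r X.
Proof.
move=> labT s bX cY; have [aE bE cE] := labels_sub labT.
have [sX sY] := separation_sub s; have [_ eqr] := separation_nspan connM aE s.
have := rankU1 M b (X :\ b); rewrite setD1K // => le1.
apply/eqP; rewrite eqn_leq rankS ?subD1set //= leqNgt; apply/negP => lt.
have [r4|r3] := leqP 4 (r X); last first.
  apply: no_good; apply: (rank3_coloop labT s bX cY (x := b));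
    by move: (sep_rankl s) r3 lt; clear; lia.
have := vconn_rank connM (subset_trans (subD1set X b) sX).
have -> : E :\: (X :\ b) = a |: (b |: Y).
  apply/setP=> z; rewrite !inE; move: (separation_mem z s).
  case: (eqVneq z b) => [->|nb]; first by rewrite bX bE; case: (b \in Y) (b == a) => [] [].
  case: (eqVneq z a) => [->|na]; first by rewrite aE; case: (a \in X) (a \in Y) => [] [].
  by case: (z \in X) (z \in Y) (z \in E) => [] [] [].
have := labels_span labT (setU11 b Y) (setU1r b cY).
have := rankS M (subsetUr [set a] (b |: Y)).
move: (rankS M (subsetUr [set b] Y)) (rankU1 M b Y) (sep_rankr s) eqr lt r4.
by clear; lia.
Qed.

Ltac by_membership x :=
  rewrite !inE;
  repeat match goal with
  | |- context [x \in ?A] => generalize (x \in A)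
  | |- context [x == ?y] => generalize (x == y)
  end;
  clear; repeat match goal with |- forall _ : bool, _ => case end; by [].

(* The four cells satisfy min(3, r R) + min(3, r L) <= 4 (with R = A1 n B2 and
   L = A2 n B1) and min(2, r P) + min(3, r Q) <= 4 (with P = A1 n B1 and
   Q = A2 n B2), by submodularity and vertical 4-connectivity; the second is
   weaker because the complement of P loses at most one from its rank when [a]
   and [b] are dropped. *)
Lemma crossing a b c A1 A2 B1 B2 : labels a b c ->
  separation M a A1 A2 -> separation M b B1 B2 ->
  b \in A1 -> c \in A2 -> a \in B1 -> c \in B2 ->
  [/\ r (A1 :&: B2) = 2, r (A2 :&: B1) = 2 &
      [/\ #|A1 :&: B1| = 1, r A1 <= 3 & r B1 <= 3]
      \/ [/\ r (A2 :&: B2) <= 2, r A2 <= 4 & r B2 <= 4]].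
Proof.
move=> labT sA sB bA cA aB cB; have [aE bE cE] := labels_sub labT.
have [_ ab _ _] := labT; have labT' := labelsC labT.
have [sA1 sA2] := separation_sub sA; have [sB1 sB2] := separation_sub sB.
have [_ eqA] := separation_nspan connM aE sA; have [_ eqB] := separation_nspan connM bE sB.
have [_ _ rA1 rA2 _] := sA; have [_ _ rB1 rB2 _] := sB.
set P := A1 :&: B1; set Q := A2 :&: B2; set R := A1 :&: B2; set L := A2 :&: B1.
have mem x : [&& ((x \in A1) || (x \in A2)) == (x \in E) && (x != a),
    ~~ ((x \in A1) && (x \in A2)),
    ((x \in B1) || (x \in B2)) == (x \in E) && (x != b),
    ~~ ((x \in B1) && (x \in B2)), (x == a) ==> (x \in B1) & (x == b) ==> (x \in A1)].
  have /andP[-> ->] := separation_mem x sA.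
  have /andP[-> ->] := separation_mem x sB; rewrite /=.
  by apply/andP; split; apply/implyP => /eqP ->.
have rank_incl X Y : (forall x, x \in X -> x \in Y) -> r X <= r Y.
  by move=> h; apply/rankS/subsetP.
pose W := A2 :|: B2.
have cW : c \in W by rewrite inE cA.
have compl_ge X Y : (forall x, x \in X -> x \in E :\: Y) -> 3 <= r X -> 3 <= r (E :\: Y).
  by move=> /rank_incl le; move: le; clear; lia.
(* The complement of [L] is [A1 :|: B2] with a, which b and c span already; that of [R] is
   [A2 :|: B1] with b, which a and c span. Two submodular inequalities then combine. *)
have le_RL : minn 3 (r R) + minn 3 (r L) <= 4.
  have sR : R \subset E by apply: subset_trans sA1; apply: subsetIl.
  have sL : L \subset E by apply: subset_trans sA2; apply: subsetIl.
  have vL : r E + minn 3 (r L) <= r L + r (A1 :|: B2).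
    have /(vconn_rank3 connM sL) : 3 <= r (E :\: L).
      apply: compl_ge rA1 => x; move: (mem x); by_membership x.
    move/leq_trans; apply; rewrite leq_add2l.
    apply: leq_trans (labels_span labT (_ : b \in A1 :|: B2) (_ : c \in A1 :|: B2)).
    - apply: rank_incl => x; move: (mem x); by_membership x.
    - by rewrite inE bA.
    by rewrite inE cB orbT.
  have vR : r E + minn 3 (r R) <= r R + r (A2 :|: B1).
    have /(vconn_rank3 connM sR) : 3 <= r (E :\: R).
      apply: compl_ge rA2 => x; move: (mem x); by_membership x.
    move/leq_trans; apply; rewrite leq_add2l.
    apply: leq_trans (labels_span labT' (_ : a \in A2 :|: B1) (_ : c \in A2 :|: B1)).
    - apply: rank_incl => x; move: (mem x); by_membership x.
    - by rewrite inE aB orbT.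
    by rewrite inE cA.
  move: eqA eqB vL vR (rank_submod M A1 B2) (rank_submod M A2 B1).
  by rewrite -/R -/L; clear; lia.
have lePW : r E + minn 2 (r P) <= r P + r W.
  have sP : P \subset E by apply: subset_trans sA1; apply: subsetIl.
  have /(vconn_rank3 connM sP) : 3 <= r (E :\: P).
    apply: compl_ge rA2 => x; move: (mem x); by_membership x.
  have leEP : r (E :\: P) <= r (a |: W).
    apply: leq_trans (labels_span labT' (setU11 a W) (setU1r a cW)).
    apply: rank_incl => x; move: (mem x); by_membership x.
  have leW := rankU1 M a W; have rW : r A2 <= r W by apply/rankS/subsetUl.
  have [r3|r2] := leqP 3 (r P); first by move: r3 leEP leW; clear; lia.
  (* For [r P] at most 2 nothing may be lost: otherwise [W] has the rank of a hyperplane, and off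
     [W] there are only a, b and points of [P]. *)
  have [leEW _|ltW vP] := leqP (r E) (r W); first by move: leEW; clear; lia.
  have hW : (r W).+1 = r E by move: vP ltW leEP leW r2; clear; lia.
  have nW : r W < r (a |: W) by move: vP leEP r2 hW; clear; lia.
  case: no_good; apply: (hyperplane_good_cocircuit labT _ cW hW _ nW (y := a) (z := b)).
  - by rewrite subUset sA2.
  - exact: leq_trans rA2 rW.
  apply: leq_trans (_ : _ <= r P) r2; apply: rank_incl => x; move: (mem x); by_membership x.
have lePQ : minn 2 (r P) + minn 3 (r Q) <= 4.
  have sQ : Q \subset E by apply: subset_trans sA2; apply: subsetIl.
  have vQ : r E + minn 3 (r Q) <= r Q + r (A1 :|: B1).
    have /(vconn_rank3 connM sQ) : 3 <= r (E :\: Q).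
      apply: compl_ge rA1 => x; move: (mem x); by_membership x.
    move/leq_trans; apply; rewrite leq_add2l.
    apply: rank_incl => x; move: (mem x); by_membership x.
  move: eqA eqB vQ lePW (rank_submod M A1 B1) (rank_submod M A2 B2).
  by rewrite -/P -/Q -/W; clear; lia.
(* The point b lies in [A1] but in neither side of its own separation; the cells cover [A1 :\ b],
   which has the full rank because b is not a coloop. *)
have lePR : r A1 <= r P + r R.
  rewrite -(separation_not_coloop labT sA bA cA).
  apply: leq_trans (rankU _ _ _); apply: rank_incl => x; move: (mem x); by_membership x.
have lePL : r B1 <= r P + r L.
  rewrite -(separation_not_coloop labT' sB aB cB).
  apply: leq_trans (rankU _ _ _); apply: rank_incl => x; move: (mem x); by_membership x.
have leQL : r A2 <= r Q + r L.
  apply: leq_trans (rankU _ _ _); apply: rank_incl => x; move: (mem x); by_membership x.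
have leQR : r B2 <= r Q + r R.
  apply: leq_trans (rankU _ _ _); apply: rank_incl => x; move: (mem x); by_membership x.
have point X : X \subset E -> r X = 1 -> exists x, X = [set x].
  move=> sX rX; apply/cards1P/eqP.
  by move: (simple_rank_ge simpleM sX) (rank_le_card M X); rewrite rX; clear; lia.
(* If [R] were a point p, then [r P >= 2], so [r Q <= 2]; [B2] would have rank 3 and consist of p
   and points of [Q]. *)
have rR : r R != 1.
  apply/negP => /eqP rR; have [|p Rp] := point R _ rR.
    by apply: subset_trans sA1; apply: subsetIl.
  case: no_good; apply: (rank3_coloop (labels_rot labT) (separationC sB) cB aB (x := p)).
    by move: rB2 lePQ lePR leQR rA1 rR; clear; lia.
  have : r (B2 :\ p) <= r Q; last by move: lePQ lePR rA1 rR; clear; lia.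
  apply: rank_incl => x; move: (mem x) (congr1 (fun X : {set S} => x \in X) Rp).
  by_membership x.
have rL : r L != 1.
  apply/negP => /eqP rL; have [|p Lp] := point L _ rL.
    by apply: subset_trans sA2; apply: subsetIl.
  case: no_good; apply: (rank3_coloop (labels_rot labT') (separationC sA) cA bA (x := p)).
    by move: rA2 lePQ lePL leQL rB1 rL; clear; lia.
  have : r (A2 :\ p) <= r Q; last by move: lePQ lePL rB1 rL; clear; lia.
  apply: rank_incl => x; move: (mem x) (congr1 (fun X : {set S} => x \in X) Lp).
  by_membership x.
(* Rank 0 falls to the same count, and rank 3 or more in one cell leaves at most 1 for the other. *)
have [rR2 rL2] : r R = 2 /\ r L = 2.
  by move: rR rL le_RL lePQ lePR lePL leQL leQR rA1 rA2 rB1 rB2; clear; lia.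
split=> //; have [rP|rP] := leqP (r P) 1; last first.
  right; have rQ : r Q <= 2 by move: lePQ rP; clear; lia.
  by move: leQL leQR rQ; rewrite rR2 rL2; clear=> *; split; lia.
left; have rP1 : r P = 1 by move: lePR rR2 rA1 rP; clear; lia.
move: lePR lePL; rewrite rR2 rL2 rP1; split=> //.
have [|p ->] := point P _ rP1; last exact: cards1.
by apply: subset_trans sA1; apply: subsetIl.
Qed.

(** * Counting the points in the cells of three separations *)

(** Two points of [X] would span the line [Q] through a, putting a in the span of [Y]. *)
Lemma few_points_off_span a X Y (Q : {set S}) : X \subset E -> X \subset Y ->
  r Y < r (a |: Y) -> a |: X \subset Q -> r Q <= 2 -> #|X| <= 1.
Proof.
move=> sXE sXY nY sQ rQ; rewrite leqNgt; apply/negP => X2.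
have rX : 2 <= r X by move: (simple_rank_ge simpleM sXE) X2; clear; lia.
have := span_mono sXY (leq_trans (rankS M sQ) (leq_trans rQ rX)).
by rewrite leqNgt nY.
Qed.

Lemma card_sides a A1 A2 X : separation M a A1 A2 -> X \subset E -> a \notin X ->
  #|X| = #|X :&: A1| + #|X :&: A2|.
Proof.
move=> sA sX aX; have [cov dis _ _ _] := sA.
rewrite -cardsUI -setIUr cov setIACA setIid (_ : A1 :&: A2 = set0).
  by rewrite setI0 cards0 addn0 (setIidPl _) // subsetD1 sX.
by apply/eqP; rewrite setI_eq0.
Qed.

(** Two common points span each of the lines, so all three lie on one line. *)
Lemma three_lines_rank (U L1 L2 L3 : {set S}) : U \subset E -> 2 <= #|U| ->
  U \subset L1 -> U \subset L2 -> U \subset L3 ->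
  r L1 <= 2 -> r L2 <= 2 -> r L3 <= 2 -> r (L1 :|: L2 :|: L3) <= 2.
Proof.
move=> sU U2 sU1 sU2 sU3 r1 r2 r3.
have rU : r U = 2.
  by move: (simple_rank_ge simpleM sU) U2 (rankS M sU1) r1; clear; lia.
have sp (L : {set S}) z : U \subset L -> r L <= 2 -> z \in L -> r (z |: U) <= r U.
  move=> sL rL zL; rewrite rU; apply: leq_trans rL.
  by rewrite rankS // subUset sub1set zL.
rewrite -rU -(rank_span (X := U) (Z := L1 :|: L2 :|: L3)) ?rankS ?subsetUr //.
by move=> z /setUP[/setUP[]|]; apply: sp.
Qed.

Lemma separations_bound e f g A1 A2 B1 B2 (C1 C2 : {set S}) : labels e f g ->
  separation M e A1 A2 -> separation M f B1 B2 -> separation M g C1 C2 ->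
  f \in A1 -> g \in A2 -> e \in B1 -> g \in B2 -> e \in C1 -> f \in C2 ->
  r E <= 6 /\
  ((~ exists X : {set S}, X \subset E /\ isomorphic (restriction M X) (uniform 2 4)) ->
    #|E| <= 11).
Proof.
move=> labT sA sB sC fA gA eB gB eC fC.
have [eE fE gE] := labels_sub labT.
have labC := labelsC (labels_rot (labels_rot labT)).
have [rR1 rL1 typ1] := crossing labT sA sB fA gA eB gB.
have [rR2 rL2 typ2] := crossing labC (separationC sA) sC gA fA eC fC.
have [rR3 rL3 typ3] :=
  crossing (labels_rot labT) (separationC sB) (separationC sC) gB eB fC eC.
split.
  have [_ eA] := separation_nspan connM eE sA.
  have [_ eB'] := separation_nspan connM fE sB.
  have [_ eC'] := separation_nspan connM gE sC.
  (* In each of the eight combinations some separation has both sides of rank at most 4, and its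
     ranks sum to [r E + 2]. *)
  by case: typ1 typ2 typ3 => -[_ + +] [] [_ + +] [] [_ + +]; move: eA eB' eC'; clear; lia.
move=> noU24.
have line X : X \subset E -> r X = 2 -> 2 <= #|X| <= 3.
  move=> sX rX; rewrite -{1}rX rank_le_card leqNgt; apply/negP => X4.
  by apply: noU24; apply: (long_line_U24 simpleM sX _ X4); rewrite rX.
have [sA1 sA2] := separation_sub sA; have [sB1 sB2] := separation_sub sB.
have [sC1 sC2] := separation_sub sC.
have nin a X Y : separation M a X Y -> (a \notin X) /\ (a \notin Y).
  move=> s; move: (separation_mem a s); rewrite eqxx andbF.
  by case: (a \in X) (a \in Y) => [] [].
have [eA1 eA2] := nin _ _ _ sA; have [fB1 fB2] := nin _ _ _ sB.
have [gC1 gC2] := nin _ _ _ sC.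
have gA1 : g \notin A1 by move: (separation_mem g sA); rewrite gA andbT => /andP[].
have fA2 : f \notin A2 by move: (separation_mem f sA); rewrite fA => /andP[].
have gB1 : g \notin B1 by move: (separation_mem g sB); rewrite gB andbT => /andP[].
have eB2 : e \notin B2 by move: (separation_mem e sB); rewrite eB => /andP[].
have fC1 : f \notin C1 by move: (separation_mem f sC); rewrite fC andbT => /andP[].
have eC2 : e \notin C2 by move: (separation_mem e sC); rewrite eC => /andP[].
have subI X Y : X \subset E -> X :&: Y \subset E by apply: subset_trans; apply: subsetIl.
(* A double cell missing the point deleted by the third separation is cut by it into exactly two
   triple cells. *)
have cAB1 : #|A1 :&: B2| = #|A1 :&: B2 :&: C1| + #|A1 :&: B2 :&: C2|.
  by apply: (card_sides sC); rewrite ?subI // inE (negPf gA1).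
have cAB2 : #|A2 :&: B1| = #|A2 :&: B1 :&: C1| + #|A2 :&: B1 :&: C2|.
  by apply: (card_sides sC); rewrite ?subI // inE (negPf gB1) andbF.
have cAB3 : #|A1 :&: B1| = #|A1 :&: B1 :&: C1| + #|A1 :&: B1 :&: C2|.
  by apply: (card_sides sC); rewrite ?subI // inE (negPf gA1).
have cAC1 : #|A2 :&: C2| = #|A2 :&: B1 :&: C2| + #|A2 :&: B2 :&: C2|.
  by rewrite ![_ :&: _ :&: C2]setIAC;
     apply: (card_sides sB); rewrite ?subI // inE (negPf fA2).
have cAC2 : #|A1 :&: C1| = #|A1 :&: B1 :&: C1| + #|A1 :&: B2 :&: C1|.
  by rewrite ![_ :&: _ :&: C1]setIAC;
     apply: (card_sides sB); rewrite ?subI // inE (negPf fC1) andbF.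
have cAC3 : #|A2 :&: C1| = #|A2 :&: B1 :&: C1| + #|A2 :&: B2 :&: C1|.
  by rewrite ![_ :&: _ :&: C1]setIAC;
     apply: (card_sides sB); rewrite ?subI // inE (negPf fA2).
have cBC1 : #|B2 :&: C1| = #|A1 :&: B2 :&: C1| + #|A2 :&: B2 :&: C1|.
  by rewrite -!setIA ![A1 :&: _]setIC ![A2 :&: _]setIC;
     apply: (card_sides sA); rewrite ?subI // inE (negPf eB2).
have cBC2 : #|B1 :&: C2| = #|A1 :&: B1 :&: C2| + #|A2 :&: B1 :&: C2|.
  by rewrite -!setIA ![A1 :&: _]setIC ![A2 :&: _]setIC;
     apply: (card_sides sA); rewrite ?subI // inE (negPf eC2) !andbF.
have cBC3 : #|B2 :&: C2| = #|A1 :&: B2 :&: C2| + #|A2 :&: B2 :&: C2|.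
  by rewrite -!setIA ![A1 :&: _]setIC ![A2 :&: _]setIC;
     apply: (card_sides sA); rewrite ?subI // inE (negPf eB2).
have cells X : X \subset E -> e \notin X -> f \notin X -> g \notin X ->
    #|X| = #|X :&: (A1 :&: B1 :&: C1)| + #|X :&: (A1 :&: B2 :&: C2)|
         + #|X :&: (A2 :&: B2 :&: C1)| + #|X :&: (A1 :&: B2 :&: C1)|
         + (#|X :&: (A1 :&: B1 :&: C2)| + #|X :&: (A2 :&: B1 :&: C1)|
         + #|X :&: (A2 :&: B2 :&: C2)| + #|X :&: (A2 :&: B1 :&: C2)|).
  move=> sX eX fX gX; rewrite (card_sides sA) //.
  rewrite (card_sides sB (X := X :&: A1)) ?subI ?inE ?(negPf fX) //.
  rewrite (card_sides sB (X := X :&: A2)) ?subI ?inE ?(negPf fX) //.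
  rewrite (card_sides sC (X := X :&: A1 :&: B1)) ?subI ?inE ?(negPf gX) //.
  rewrite (card_sides sC (X := X :&: A1 :&: B2)) ?subI ?inE ?(negPf gX) //.
  rewrite (card_sides sC (X := X :&: A2 :&: B1)) ?subI ?inE ?(negPf gX) //.
  rewrite (card_sides sC (X := X :&: A2 :&: B2)) ?subI ?inE ?(negPf gX) //.
  by rewrite !setIA; clear; lia.
have nspan a X Y : a \in E -> separation M a X Y -> r X < r (a |: X).
  by move=> aE /(separation_nspan connM aE)[].
have few a X Y (Z : {set S}) : r Y < r (a |: Y) -> Z \subset E -> a \in Z -> r Z <= 2 ->
    X \subset Y -> X \subset Z -> #|X| <= 1.
  move=> nY sZ aZ rZ sXY sXZ.
  apply: (few_points_off_span (subset_trans sXZ sZ) sXY nY _ rZ).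
  by rewrite subUset sub1set aZ.
have cE : #|E :\: T| <= 8.
  rewrite cells ?subsetDl //; last first.
  - by have [-> _ _ _] := labT; rewrite !inE eqxx ?orbT.
  - by have [-> _ _ _] := labT; rewrite !inE eqxx ?orbT.
  - by have [-> _ _ _] := labT; rewrite !inE eqxx ?orbT.
  apply: leq_trans (_ : _ <= #|A1 :&: B1 :&: C1| + #|A1 :&: B2 :&: C2|
         + #|A2 :&: B2 :&: C1| + #|A1 :&: B2 :&: C1|
         + (#|A1 :&: B1 :&: C2| + #|A2 :&: B1 :&: C1|
         + #|A2 :&: B2 :&: C2| + #|A2 :&: B1 :&: C2|)) _.
    by rewrite !leq_add // subset_leq_card // subsetIr.
  (* Here u counts [A1 :&: B2 :&: C1], common to the lines [A1 :&: C1], [A1 :&: B2] and [B2 :&: C1];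
     v counts [A2 :&: B1 :&: C2], common to the other three. *)
  apply: cell_count.
  - by rewrite -cAC2 line ?subI.
  - by rewrite addnC -cAB1 line ?subI.
  - by rewrite addnC -cBC1 line ?subI.
  - by rewrite -cBC2 line ?subI.
  - by rewrite -cAB2 line ?subI.
  - by rewrite addnC -cAC1 line ?subI.
  (* Two points in the common cell merge the three lines into one, which has at most three points in
     all. *)
  - move=> U2; set X := A1 :&: C1 :|: A1 :&: B2 :|: B2 :&: C1.
    have sX : X \subset E by rewrite !subUset !subI.
    have rX : r X <= 2.
      apply: (three_lines_rank _ U2); rewrite ?rR1 ?rL2 ?rR3 ?subI //.
      - by apply/subsetP=> x; rewrite !inE => /andP[/andP[-> _] ->].
      - by apply: subsetIl.
      by rewrite -setIA subsetIr.
    have [|lt] := leqP #|X| 3; last by case: noU24; apply: (long_line_U24 simpleM sX rX lt).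
    have gX : g \notin X by rewrite !inE (negPf gA1) (negPf gC1) !andbF.
    have fX : f \notin X by rewrite !inE (negPf fC1) (negPf fB2) !andbF.
    have eX : e \notin X by rewrite !inE (negPf eA1) (negPf eB2).
    apply: leq_trans; rewrite (cells X) //.
    apply: leq_trans (leq_addr _ _); rewrite !leq_add //
      subset_leq_card // subsetI subxx andbT;
      by apply/subsetP=> x; rewrite !inE => /andP[/andP[xa xb] xc];
         rewrite ?xa ?xb ?xc ?orbT.
  - move=> V2; set X := B1 :&: C2 :|: A2 :&: B1 :|: A2 :&: C2.
    have sX : X \subset E by rewrite !subUset !subI.
    have rX : r X <= 2.
      apply: (three_lines_rank _ V2); rewrite ?rL1 ?rR2 ?rL3 ?subI //.
      - by rewrite -setIA subsetIr.
      - by apply: subsetIl.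
      by apply/subsetP=> x; rewrite !inE => /andP[/andP[-> _] ->].
    have [|lt] := leqP #|X| 3; last by case: noU24; apply: (long_line_U24 simpleM sX rX lt).
    have gX : g \notin X by rewrite !inE (negPf gB1) (negPf gC2) !andbF.
    have fX : f \notin X by rewrite !inE (negPf fB1) (negPf fA2).
    have eX : e \notin X by rewrite !inE (negPf eA2) (negPf eC2) !andbF.
    apply: leq_trans; rewrite (cells X) //.
    apply: leq_trans (leq_addl _ _); rewrite !leq_add //
      subset_leq_card // subsetI subxx andbT;
      by apply/subsetP=> x; rewrite !inE => /andP[/andP[xa xb] xc];
         rewrite ?xa ?xb ?xc ?orbT.
  (* Either [A1 :&: B1] is a single point, or [A2 :&: B2] is a line through g; neither [C1] nor [C2]
     spans g, so each meets that line in at most one point. *)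
  - case: typ1 => [[<- _ _]|[rQ _ _]]; [by left|right].
    have gQ : g \in A2 :&: B2 by rewrite inE gA.
    split; first by apply: (few _ _ _ _ (nspan _ _ _ gE sC) _ gQ rQ);
      rewrite ?subI ?subsetIr ?subsetIl.
    by apply: (few _ _ _ _ (nspan _ _ _ gE (separationC sC)) _ gQ rQ);
      rewrite ?subI ?subsetIr ?subsetIl.
  - case: typ2 => [[<- _ _]|[rQ _ _]]; [by left|right].
    have fQ : f \in A1 :&: C2 by rewrite inE fA.
    split; rewrite setIAC.
      by apply: (few _ _ _ _ (nspan _ _ _ fE (separationC sB)) _ fQ rQ);
        rewrite ?subI ?subsetIr ?subsetIl.
    by apply: (few _ _ _ _ (nspan _ _ _ fE sB) _ fQ rQ);
      rewrite ?subI ?subsetIr ?subsetIl.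
  case: typ3 => [[<- _ _]|[rQ _ _]]; [by left|right].
  have eQ : e \in B1 :&: C1 by rewrite inE eB.
  rewrite -!setIA; split.
    by apply: (few _ _ _ _ (nspan _ _ _ eE sA) _ eQ rQ);
      rewrite ?subI ?subsetIr ?subsetIl.
  by apply: (few _ _ _ _ (nspan _ _ _ eE (separationC sA)) _ eQ rQ);
    rewrite ?subI ?subsetIr ?subsetIl.
have /andP[_ /eqP cT] := triT.
rewrite -(cardsID T E) (setIidPr subT) cT.
by move: cE; clear; lia.
Qed.

End Triangle.

(** * Combining the three deletions *)

Theorem theorem1p8 (S : finType) (M : matroid S) (T : {set S}) (e f g : S)
  (simpleM : simple_matroid M)
  (connM : vertically_connected M 4)
  (defT : T = [set e; f; g])
  (triT : triangle M T)
  (nconn_e : ~ vertically_connected (deletion M [set e]) 4)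
  (nconn_f : ~ vertically_connected (deletion M [set f]) 4)
  (nconn_g : ~ vertically_connected (deletion M [set g]) 4) :
  (exists C : {set S},
     [/\ cocircuit M C, #|C :&: T| = 2 &
         exists k : nat, 2 <= k /\
           isomorphic (restriction M C)
                      (direct_sum (uniform 2 k) (uniform 2 2))])
  \/
  (rank M (ground M) <= 6 /\
   ((~ exists X : {set S}, X \subset ground M /\
         isomorphic (restriction M X) (uniform 2 4)) ->
    #|ground M| <= 11)).
Proof.
have labT : labels T e f g.
  have /andP[_ /eqP] := triT; rewrite /labels defT.
  have [->|ef] := eqVneq e f; first by rewrite setUid cards2; case: (f != g).
  have [->|eg] := eqVneq e g; first by rewrite setUAC setUid cards2; case: (g != f).
  by have [->|fg] := eqVneq f g; first by rewrite -setUA setUid cards2; case: (e != g).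
have labTf := labelsC labT; have labTg := labels_rot (labels_rot labT).
have [eE fE gE] := labels_sub triT labT.
have [good|no_good] := classic (has_good_cocircuit M T); [by left|right].
have [[A1 [A2 [sA fA gA]]]|[X [Y [cov rX rY]]]] :=
  deletion_separation simpleM connM triT labT nconn_e;
  last exact: small_sides_bound cov rX rY.
have [[B1 [B2 [sB eB gB]]]|[X [Y [cov rX rY]]]] :=
  deletion_separation simpleM connM triT labTf nconn_f;
  last exact: small_sides_bound cov rX rY.
have [[C1 [C2 [sC eC fC]]]|[X [Y [cov rX rY]]]] :=
  deletion_separation simpleM connM triT labTg nconn_g;
  last exact: small_sides_bound cov rX rY.
exact: (separations_bound simpleM connM triT no_good labT sA sB sC).
Qed.
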